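(* Let $I\subset\mathbb{R}$ be an open interval and let $r,\theta,a_1,a_2:I\to\mathbb{R}$ be smooth functions with $r$ nowhere zero. Let $D\subset\mathbb{R}^2$ be a domain and let $f$ be a smooth real function of one variable such that $f(z_2)$ is defined for all $(z_1,z_2)\in D$. Put $$R=\begin{pmatrix} r & r a_1 & r a_2\\ 0 & 1/r & 0\end{pmatrix},\qquad A=M(\theta)R,\qquad v(z)=\big(z_1,z_2,f(z_2)\big),\qquad \varphi(z,t)=A(t)v(z).$$ If $$a_1'=\frac{2\theta'}{r^2}\qquad\text{and}\qquad a_2'=-\frac1{r^2},$$ then $\varphi$ gives a solution to the two-dimensional incompressible Euler equations, and $$\det(d\varphi)=1,\qquad \zeta=f'(z_2).$$
   Context: $M(\theta)=\begin{pmatrix}\cos\theta&-\sin\theta\\ \sin\theta&\cos\theta\end{pmatrix}$. A prime denotes the derivative of a function of one variable. For $\varphi:D\times I\to\mathbb{R}^2$ smooth, $d\varphi$ is the $2\times2$ Jacobian matrix with respect to $z=(z_1,z_2)$ only. Meaning of ''gives a solution'': assume $\det(d\varphi)\neq0$ everywhere. Then $(z,t)\mapsto(\varphi(z,t),t)$ is a local diffeomorphism, so near every point it determines a velocity field $u(x,t)$ by $\partial_t\varphi(z,t)=u(\varphi(z,t),t)$. We say that $\varphi$ gives a solution to the Euler equations if near every point this $u$ satisfies, for some smooth (locally defined) pressure $p$, the equations $u_t+(u\cdot\nabla)u+\nabla p=0$ and $\nabla\cdot u=0$. The vorticity in the $z$ coordinates is $\zeta(z,t)=\big(\partial_{x_1}u^2-\partial_{x_2}u^1\big)(\varphi(z,t),t)$.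 *)

(* Defs.v *)
From HB Require Import structures.
From mathcomp Require Import all_boot all_order all_algebra.
From mathcomp Require Import all_classical all_reals all_analysis.
Import Order.TTheory GRing.Theory Num.Theory.
Import numFieldNormedType.Exports.

Set Implicit Arguments.
Unset Strict Implicit.
Unset Printing Implicit Defensive.

Local Open Scope classical_set_scope.
Local Open Scope ring_scope.

(* Functions are total; only their restrictions to an open set [U] matter.
   [Ck_on] asks that all iterated directional derivatives of order at most [k]
   exist and are continuous on [U]. For finite-dimensional [V], the only case
   in which it is used, this is the usual class C^k. *)
Fixpoint Ck_on (R : realType) (V W : normedModType R) (k : nat) (U : set V)
    (f : V -> W) : Prop :=
  (forall x, U x -> {for x, continuous f}) /\
  match k with
  | 0 => True
  | k'.+1 => forall v : V,
      (forall x, U x -> derivable f x v) /\ Ck_on k' U (fun x => 'D_v f x)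
  end.

Definition smooth_on (R : realType) (V W : normedModType R) (U : set V)
  (f : V -> W) : Prop := forall k, Ck_on k U f.

Section PlanarFlow.
Variable R : realType.

(* Points of the plane are row vectors, with z_1 = z 0 0 and z_2 = z 0 1. *)
Definition basis2 (j : 'I_2) : 'rV[R]_2 := delta_mx 0 j.

Definition pd (W : normedModType R) (j : 'I_2) (g : 'rV[R]_2 -> W)
  (x : 'rV[R]_2) : W := 'D_(basis2 j) g x.

Definition grad (g : 'rV[R]_2 -> R) (x : 'rV[R]_2) : 'rV[R]_2 :=
  \row_j pd j g x.

Definition divergence (w : 'rV[R]_2 -> 'rV[R]_2) (x : 'rV[R]_2) : R :=
  \sum_j pd j (fun y => w y 0 j) x.

Definition curl (w : 'rV[R]_2 -> 'rV[R]_2) (x : 'rV[R]_2) : R :=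
  pd 0 (fun y => w y 0 1) x - pd 1 (fun y => w y 0 0) x.

(* (w . nabla) w *)
Definition convect (w : 'rV[R]_2 -> 'rV[R]_2) (x : 'rV[R]_2) : 'rV[R]_2 :=
  \sum_j w x 0 j *: pd j w x.

(* [jacobian] acts on row vectors from the right, hence the transpose: the
   (i, j) entry is the derivative of the i-th component along z_j. *)
Definition dz (phi : 'rV[R]_2 -> R -> 'rV[R]_2) (z : 'rV[R]_2) (t : R)
  : 'M[R]_2 := (jacobian (fun y => phi y t) z)^T.

Definition spacetime (phi : 'rV[R]_2 -> R -> 'rV[R]_2) (q : 'rV[R]_2 * R)
  : 'rV[R]_2 * R := (phi q.1 q.2, q.2).

(* [W] is an open set on which (z, t) |-> (phi(z, t), t) is injective with open
   image, and [u] is the velocity field of phi on that image. The values of [u]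
   outside the image of [W] are irrelevant. *)
Definition local_velocity (D : set 'rV[R]_2) (I : set R)
    (phi : 'rV[R]_2 -> R -> 'rV[R]_2) (W : set ('rV[R]_2 * R))
    (u : 'rV[R]_2 -> R -> 'rV[R]_2) : Prop :=
  [/\ open W, W `<=` D `*` I, {in W &, injective (spacetime phi)},
      open (spacetime phi @` W) &
      forall z t, W (z, t) -> derive1 (phi z) t = u (phi z t) t].

Definition euler_on (Q : set ('rV[R]_2 * R)) (u : 'rV[R]_2 -> R -> 'rV[R]_2)
    (p : 'rV[R]_2 -> R -> R) : Prop :=
  forall x t, Q (x, t) ->
    derive1 (u x) t + convect (u^~ t) x + grad (p^~ t) x = 0 /\
    divergence (u^~ t) x = 0.

Definition gives_euler_solution (D : set 'rV[R]_2) (I : set R)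
    (phi : 'rV[R]_2 -> R -> 'rV[R]_2) : Prop :=
  [/\ smooth_on (D `*` I) (fun q => phi q.1 q.2),
      forall z t, D z -> I t -> \det (dz phi z t) != 0 &
      forall z t, D z -> I t ->
        exists (W : set ('rV[R]_2 * R)) (u : 'rV[R]_2 -> R -> 'rV[R]_2)
          (p : 'rV[R]_2 -> R -> R),
          [/\ W (z, t), local_velocity D I phi W u,
              smooth_on (spacetime phi @` W) (fun q => u q.1 q.2),
              smooth_on (spacetime phi @` W) (fun q => p q.1 q.2) &
              euler_on (spacetime phi @` W) u p]].

(* The velocity is only defined locally, so the vorticity in the z coordinates
   is specified through every local velocity field. *)
Definition is_vorticity (D : set 'rV[R]_2) (I : set R)
    (phi : 'rV[R]_2 -> R -> 'rV[R]_2) (zeta : 'rV[R]_2 -> R -> R) : Prop :=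
  forall W u, local_velocity D I phi W u ->
    forall z t, W (z, t) -> zeta z t = curl (u^~ t) (phi z t).

Definition mx_of_rows (m n : nat) (s : seq (seq R)) : 'M[R]_(m, n) :=
  \matrix_(i, j) nth 0 (nth [::] s i) j.

Definition rotmx (th : R) : 'M[R]_2 :=
  mx_of_rows 2 2 [:: [:: cos th; - sin th];
                     [:: sin th; cos th]].

Definition Rmx (r a1 a2 : R) : 'M[R]_(2, 3) :=
  mx_of_rows 2 3 [:: [:: r; r * a1; r * a2];
                     [:: 0; r^-1; 0]].

Definition Amx (r theta a1 a2 : R -> R) (t : R) : 'M[R]_(2, 3) :=
  rotmx (theta t) *m Rmx (r t) (a1 t) (a2 t).

Definition vvec (f : R -> R) (z : 'rV[R]_2) : 'cV[R]_3 :=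
  (mx_of_rows 1 3 [:: [:: z 0 0; z 0 1; f (z 0 1)]])^T.

Definition flow (r theta a1 a2 f : R -> R) (z : 'rV[R]_2) (t : R)
  : 'rV[R]_2 := (Amx r theta a1 a2 t *m vvec f z)^T.

End PlanarFlow.

(* Main.v *)
(* In the rotating frame w = M(-theta) x the flow is w = R(t) v(z), and z is
   recovered explicitly: z_2 = r w_2, z_1 = w_1 / r - a_1 z_2 - a_2 f(z_2). So
   velocity, divergence, curl and acceleration are explicit functions of (x, t).
   The equations for a_1' and a_2' make dw_1/dt equal to
   (r'/r) w_1 + 2 theta' w_2 - f(r w_2) / r, whose last two terms give vorticity
   f' once the rotation is added, and they cancel the antisymmetric part of the
   acceleration gradient. The pressure is then a quadratic form in w plus
   2 theta' F(r w_2) / r^2 with F' = f; a local primitive F suffices, since the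
   flow has only to be inverted near each point. *)
Require Import Defs.
From HB Require Import structures.
From mathcomp Require Import all_boot all_order all_algebra.
From mathcomp Require Import all_classical all_reals all_analysis.
From mathcomp Require Import ring.
Import Order.TTheory GRing.Theory Num.Theory.
Import numFieldNormedType.Exports.
Set Implicit Arguments.
Unset Strict Implicit.
Unset Printing Implicit Defensive.

Local Open Scope classical_set_scope.
Local Open Scope ring_scope.

(** * Directional derivatives and smooth functions *)

(** Each ingredient [X] of the velocity gets one closed formula [dX q v] for its derivative at [q]
    in the space-time direction [v]. The direction [(basis2 R j, 0)] gives partial derivatives,
    [(0, 1)] the time derivative, and [(velocity q, 1)] the derivative along particle paths.
    Linearity in [v] turns u_t + (u . nabla) u into the last one, for which the frame components
    differentiate to the slip and z_2 to zero, so f' never reaches the acceleration. The constants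
    can be read off in the frame. The turning of the frame contributes the antisymmetric term
    theta'' (-w_2, w_1); the slip term 2 theta' w_2, which comes from a_1', adds 2 theta'' w_2 to
    the first component and leaves the symmetric theta'' (w_2, w_1). The Coriolis term acting on
    that slip gives 4 theta'^2 w_2 and the centrifugal term removes one, hence the 3 in
    [pressure22]. The derivative of the slip term -f / r cancels against the strain of that same
    term, so f survives only in the second component, where it depends on w_2 and t alone. *)

Section DirectionalDerivatives.
Context {R : realType} {V : normedModType R}.
Implicit Types (x v : V).

Lemma is_derive_add (W : normedModType R) (f g : V -> W) x v df dg :
  is_derive x v f df -> is_derive x v g dg ->
  is_derive x v (fun y => f y + g y) (df + dg).
Proof. exact: is_deriveD. Qed.

Lemma is_derive_opp (W : normedModType R) (f : V -> W) x v df :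
  is_derive x v f df -> is_derive x v (fun y => - f y) (- df).
Proof. exact: is_deriveN. Qed.

Lemma is_derive_mul (f g : V -> R) x v (df dg : R) :
  is_derive x v f df -> is_derive x v g dg ->
  is_derive x v (fun y => f y * g y) (f x * dg + g x * df).
Proof. exact: is_deriveM. Qed.

Lemma is_derive_const (W : normedModType R) (a : W) x v :
  is_derive x v (fun=> a) 0.
Proof. exact: is_derive_cst. Qed.

(** The difference quotient is constant for nonzero [h], so its limit exists without any continuity
    of [l]. *)
Lemma is_derive_additive (W : normedModType R) (l : V -> W) x v :
  (forall h : R, l (h *: v + x) = h *: l v + l x) -> is_derive x v l (l v).
Proof.
move=> lin; suff cl : h^-1 *: (l (h *: v + x) - l x) @[h --> 0^'] --> l v.
  by split; [exact: cvgP cl | exact: cvg_lim cl].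
refine (cvg_trans (near_eq_cvg _) (cvg_cst (l v))).
near=> h; have h0 : h != 0 by near: h; exact: nbhs_dnbhs_neq.
by rewrite /= lin addrK scalerA mulVf ?scale1r.
Unshelve. all: by end_near. Qed.

(* Only [f] restricted to a line matters, so the one-variable chain rule
   applies and no Frechet differentiability of [f] is needed. *)
Lemma is_derive_comp1 (W : normedModType R) (g : R -> W) (f : V -> R) x v df dg :
  is_derive x v f df -> is_derive (f x) 1 g dg ->
  is_derive x v (fun y => g (f y)) (df *: dg).
Proof.
move=> [fx fE] [gx gE].
have lineE (U : normedModType R) (k : V -> U) :
    'D_v k x = 'D_1 (fun h : R => k (h *: v + x)) 0.
  rewrite /derive; set g1 := fun h => h^-1 *: _; set g2 := fun h => h^-1 *: _.
  suff -> : g1 = g2 by [].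
  by apply/funext => h; rewrite /g1 /g2 /= addr0 scale0r add0r [_%:A]mulr1.
have dl : differentiable (fun h : R => f (h *: v + x)) 0.
  by apply/derivable1_diffP; apply: (derivable1P _ _ _).1.
have dg' : differentiable g (f (0 *: v + x)).
  by rewrite scale0r add0r; exact/derivable1_diffP.
have dc : differentiable (g \o (fun h : R => f (h *: v + x))) 0.
  exact: differentiable_comp.
apply: DeriveDef.
  by apply/derivable1P; apply/derivable1_diffP.
have dfE : 'd (fun h : R => f (h *: v + x)) 0 1 = df.
  by rewrite -(deriveE _ dl) -lineE.
rewrite lineE (deriveE _ dc) (diff_comp dl dg') /= dfE.
(* A linear map on the line is determined by its value at 1, and for the differential of [g] that
   value is [dg]. *)
have -> : df = df *: (1 : R) by rewrite -[RHS]/(_ * _) mulr1.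
by rewrite linearZ -(deriveE _ dg') scale0r add0r gE [_ *: 1]mulr1.
Qed.

Lemma is_derive_comp (g : R -> R) (f : V -> R) x v df dg :
  is_derive x v f df -> is_derive (f x) 1 g dg ->
  is_derive x v (fun y => g (f y)) (dg * df).
Proof. by move=> fx gx; rewrite mulrC; exact: is_derive_comp1. Qed.

End DirectionalDerivatives.

Lemma is_derive_scale (R : realType) (V W : normedModType R) (a : V -> R) (w : W) (x v : V) da :
  is_derive x v a da -> is_derive x v (fun y => a y *: w) (da *: w).
Proof.
move=> ax; apply: (@is_derive_comp1 _ _ _ (fun s : R => s *: w)) => //.
rewrite -[X in is_derive _ _ _ X]scale1r.
by apply: is_derive_additive => h; rewrite scalerDl scalerA.
Qed.

Lemma is_derive_inv (R : realType) (t : R) :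
  t != 0 -> is_derive t 1 (fun s : R => s^-1) (- (t^-1 * t^-1)).
Proof.
move=> t0; apply: DeriveDef; first exact: (@derivableV _ _ id).
rewrite (@deriveV _ _ id) // derive_id /= -[_ *: _]/(_ * _) mulr1.
by rewrite expr2 invfM.
Qed.

(** * Closure properties of C^k functions on an open set *)

Section Smoothness.
Context {R : realType} {V : normedModType R}.
Implicit Types (U : set V) (k : nat).

Lemma near_continuous (W : normedModType R) (f g : V -> W) x :
  {near x, f =1 g} -> {for x, continuous f} -> {for x, continuous g}.
Proof.
move=> fg; rewrite /prop_for /continuous_at -(nbhs_singleton fg) => cf.
by apply: cvg_trans cf; exact: near_eq_cvg.
Qed.

Lemma Ck_on_continuous (W : normedModType R) k U (f : V -> W) :
  Ck_on k U f -> forall x, U x -> {for x, continuous f}.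
Proof. by case: k => [|k] []. Qed.

(** The product and chain rules leave factors that are not differentiated; these have one order to
    spare in the inductions below. *)
Lemma Ck_onW (W : normedModType R) k U (f : V -> W) :
  Ck_on k.+1 U f -> Ck_on k U f.
Proof.
elim: k f => [|k IH] f [cf df]; first by split.
by split=> // v; have [? /IH] := df v.
Qed.

Lemma Ck_on_subset (W : normedModType R) k U U' (f : V -> W) :
  U' `<=` U -> Ck_on k U f -> Ck_on k U' f.
Proof.
move=> sU; elim: k f => [|k IH] f [cf df]; first by split=> // x /sU /cf.
split=> [x /sU /cf //|v]; have [dv /IH ?] := df v.
by split=> // x /sU /dv.
Qed.

(** Openness turns equality on [U] into equality near each point of [U], so the derivatives agree on
    [U] as well and the induction goes on. *)
Lemma eq_Ck_on (W : normedModType R) k U (f g : V -> W) : open U ->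
  (forall x, U x -> f x = g x) -> Ck_on k U f -> Ck_on k U g.
Proof.
move=> oU; elim: k f g => [|k IH] f g fg [cf df].
all: have nfg x : U x -> {near x, f =1 g}
  by move=> Ux; apply: filterS (open_nbhs_nbhs (conj oU Ux)).
all: split=> //.
all: try by move=> x Ux; apply: near_continuous (nfg x Ux) (cf x Ux).
- move=> v; have [dv Cv] := df v; split.
    by move=> x Ux; apply: near_eq_derivable (dv _ Ux); exact: nfg.
  apply: IH Cv => x Ux; apply: near_eq_derive; exact: nfg.
Qed.

(** The common induction step for the order: it lets an explicit formula [df], valid only on [U],
    stand in for the total function ['D_v f]. *)
Lemma Ck_onS (W : normedModType R) k U (f : V -> W) (df : V -> V -> W) :
  open U -> (forall x, U x -> {for x, continuous f}) ->
  (forall x v, U x -> is_derive x v f (df v x)) ->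
  (forall v, Ck_on k U (df v)) -> Ck_on k.+1 U f.
Proof.
move=> oU cf isd Cd; split=> // v; split.
  by move=> x Ux; have [] := isd x v Ux.
by apply: eq_Ck_on (Cd v) => // x Ux; have [_ ->] := isd x v Ux.
Qed.

Lemma Ck_on_is_derive (W : normedModType R) k U (f : V -> W) x v :
  Ck_on k.+1 U f -> U x -> is_derive x v f ('D_v f x).
Proof. by move=> [_ /(_ v)[df _]] Ux; apply: derivableP; exact: df. Qed.

Lemma Ck_on_cst (W : normedModType R) k U (a : W) :
  open U -> Ck_on k U (fun=> a).
Proof.
move=> oU; elim: k a => [|k IH] a; first by split=> // x _; exact: cst_continuous.
apply: (@Ck_onS _ _ _ _ (fun _ _ => 0)) => // x _.
exact: cst_continuous.
Qed.

Lemma Ck_onD (W : normedModType R) k U (f g : V -> W) : open U ->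
  Ck_on k U f -> Ck_on k U g -> Ck_on k U (fun x => f x + g x).
Proof.
move=> oU; elim: k f g => [|k IH] f g Cf Cg.
all: have cfg x : U x -> {for x, continuous (fun x => f x + g x)}
  by move=> Ux; apply: cvgD; [exact: (Ck_on_continuous Cf) | exact: (Ck_on_continuous Cg)].
  by split.
apply: (@Ck_onS _ _ _ _ (fun v x => 'D_v f x + 'D_v g x)) => // [x v Ux|v].
  by apply: is_derive_add; [exact: Ck_on_is_derive Cf Ux | exact: Ck_on_is_derive Cg Ux].
by apply: IH; [have [_ /(_ v)[]] := Cf | have [_ /(_ v)[]] := Cg].
Qed.

Lemma Ck_onM k U (f g : V -> R) : open U ->
  Ck_on k U f -> Ck_on k U g -> Ck_on k U (fun x => f x * g x).
Proof.
move=> oU; elim: k f g => [|k IH] f g Cf Cg.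
all: have cfg x : U x -> {for x, continuous (fun x => f x * g x)}
  by move=> Ux; apply: cvgM; [exact: (Ck_on_continuous Cf) | exact: (Ck_on_continuous Cg)].
  by split.
apply: (@Ck_onS _ _ _ _ (fun v x => f x * 'D_v g x + g x * 'D_v f x)) => //.
  by move=> x v Ux; apply: is_derive_mul; [exact: Ck_on_is_derive Cf Ux | exact: Ck_on_is_derive Cg Ux].
move=> v; apply: Ck_onD => //; apply: IH; do ?exact: Ck_onW.
- by have [_ /(_ v)[]] := Cg.
- by have [_ /(_ v)[]] := Cf.
Qed.

End Smoothness.

Lemma Ck_on_comp (R : realType) (V : normedModType R) k (U : set V) (E : set R)
    (g : R -> R) (f : V -> R) : open U -> (forall x, U x -> E (f x)) ->
  Ck_on k E g -> Ck_on k U f -> Ck_on k U (fun x => g (f x)).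
Proof.
move=> oU UE; elim: k g f UE => [|k IH] g f UE Cg Cf.
all: have cgf x : U x -> {for x, continuous (fun x => g (f x))}
  by move=> Ux; apply: (@continuous_comp _ _ _ f g);
     [exact: (Ck_on_continuous Cf) | exact: (Ck_on_continuous Cg (UE _ Ux))].
  by split.
apply: (@Ck_onS _ _ _ _ _ _ (fun v x => 'D_1 g (f x) * 'D_v f x)) => //.
  move=> x v Ux; apply: is_derive_comp.
    exact: Ck_on_is_derive Cf Ux.
  exact: Ck_on_is_derive Cg (UE _ Ux).
move=> v; apply: Ck_onM => //.
  by apply: (IH ('D_1 g) f) => //; [have [_ /(_ 1)[]] := Cg | exact: Ck_onW].
by have [_ /(_ v)[]] := Cf.
Qed.

(** [Ck_on] quantifies over all directions even when the source is the line; this reduces them to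
    the direction 1. *)
Lemma is_derive_dir (R : realType) (g : R -> R) (t s dg : R) :
  is_derive t 1 g dg -> is_derive t s g (dg * s).
Proof.
by move=> gt; apply: (@is_derive_comp _ _ g id) => //; exact: is_derive_id.
Qed.

Section SmoothFunctions.
Context {R : realType}.
Implicit Types (V W : normedModType R) (E : set R).

Lemma smooth_cst V W (U : set V) (a : W) : open U -> smooth_on U (fun=> a).
Proof. by move=> oU k; exact: Ck_on_cst. Qed.

Lemma smooth_add V W (U : set V) (f g : V -> W) : open U ->
  smooth_on U f -> smooth_on U g -> smooth_on U (fun x => f x + g x).
Proof. by move=> oU sf sg k; exact: Ck_onD. Qed.

Lemma smooth_mul V (U : set V) (f g : V -> R) : open U ->
  smooth_on U f -> smooth_on U g -> smooth_on U (fun x => f x * g x).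
Proof. by move=> oU sf sg k; exact: Ck_onM. Qed.

Lemma smooth_comp V (U : set V) E (g : R -> R) (f : V -> R) :
  open U -> (forall x, U x -> E (f x)) ->
  smooth_on E g -> smooth_on U f -> smooth_on U (fun x => g (f x)).
Proof. by move=> oU UE sg sf k; exact: (Ck_on_comp oU UE). Qed.

Lemma smooth_subset V W (U U' : set V) (f : V -> W) :
  U' `<=` U -> smooth_on U f -> smooth_on U' f.
Proof. by move=> sU sf k; exact: Ck_on_subset (sf k). Qed.

Lemma eq_smooth V W (U : set V) (f g : V -> W) : open U ->
  (forall x, U x -> f x = g x) -> smooth_on U f -> smooth_on U g.
Proof. by move=> oU fg sf k; exact: eq_Ck_on (sf k). Qed.

Lemma smooth_continuous V W (U : set V) (f : V -> W) :
  smooth_on U f -> forall x, U x -> {for x, continuous f}.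
Proof. by move=> /(_ 0%N) [cf _]. Qed.

Lemma smooth_linear V W (U : set V) (l : V -> W) : open U -> continuous l ->
  (forall (h : R) v x, l (h *: v + x) = h *: l v + l x) -> smooth_on U l.
Proof.
move=> oU cl lin [|k]; first by split=> // x _; exact: cl.
apply: (@Ck_onS _ _ _ _ _ _ (fun v _ => l v)) => // [x _|x v _|v].
- exact: cl.
- by apply: is_derive_additive => h; exact: lin.
- exact: Ck_on_cst.
Qed.

Lemma smooth_opp V (U : set V) (f : V -> R) : open U ->
  smooth_on U f -> smooth_on U (fun x => - f x).
Proof.
move=> oU sf; apply: (@eq_smooth _ _ _ (fun x => -1 * f x)) => //.
  by move=> x _; rewrite mulN1r.
by apply: smooth_mul => //; exact: smooth_cst.
Qed.

Lemma smooth_scale V W (U : set V) (a : V -> R) (w : W) : open U ->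
  smooth_on U a -> smooth_on U (fun x => a x *: w).
Proof.
move=> oU sa k; elim: k a sa => [|k IH] a sa.
all: have ca x : U x -> {for x, continuous (fun x => a x *: w)}
  by move=> Ux; apply: cvgZr_tmp; exact: (smooth_continuous sa).
  by split.
apply: (@Ck_onS _ _ _ _ _ _ (fun v x => 'D_v a x *: w)) => // [x v Ux|v].
  by apply: is_derive_scale; exact: Ck_on_is_derive (sa 1%N) Ux.
by apply: IH => j; have [_ /(_ v)[]] := sa j.+1.
Qed.

Lemma smooth_is_derive E (g : R -> R) (t : R) :
  smooth_on E g -> E t -> is_derive t 1 g (derive1 g t).
Proof. by move=> sg Et; rewrite derive1E; exact: Ck_on_is_derive (sg 1%N) Et. Qed.

Lemma smooth_derive1 E (g : R -> R) : smooth_on E g -> smooth_on E (derive1 g).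
Proof.
move=> sg k; rewrite (_ : derive1 g = 'D_1 g); last first.
  by apply/funext => t; rewrite derive1E.
by have [_ /(_ 1)[]] := sg k.+1.
Qed.

Lemma smooth_primitive E (g dg : R -> R) : open E ->
  (forall t, E t -> is_derive t 1 g (dg t)) -> smooth_on E dg -> smooth_on E g.
Proof.
move=> oE isd sdg.
have cg t : E t -> {for t, continuous g}.
  move=> Et; have [/derivable1_diffP] := isd t Et.
  by move=> /differentiable_continuous.
case=> [|k]; first by split.
apply: (@Ck_onS _ _ _ _ _ _ (fun v t => dg t * v)) => // [t v Et|v].
  by apply: is_derive_dir; exact: isd.
by apply: Ck_onM => //; exact: Ck_on_cst.
Qed.

(** Each of the two functions is, up to sign, the derivative of the other, so the induction on the
    order must carry both. *)
Lemma smooth_trig : smooth_on setT (@cos R) /\ smooth_on setT (@sin R).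
Proof.
suff H k : Ck_on k setT (@cos R) /\ Ck_on k setT (@sin R).
  by split=> k; have [] := H k.
elim: k => [|k [Cc Cs]].
  split; split=> // t _; first exact: continuous_cos.
  exact: continuous_sin.
split.
(* The sign is written as a factor [-1], so that closure under products and constants is enough at a
   fixed order. *)
- apply: (@Ck_onS _ _ _ _ _ _ (fun v t => (-1 * sin t) * v)); first exact: openT.
  + by move=> t _; exact: continuous_cos.
  + by move=> t v _; rewrite mulN1r; apply: is_derive_dir; exact: is_derive_cos.
  + by move=> v; do !apply: Ck_onM; do ?apply: Ck_on_cst; try exact: openT.
- apply: (@Ck_onS _ _ _ _ _ _ (fun v t => cos t * v)); first exact: openT.
  + by move=> t _; exact: continuous_sin.
  + by move=> t v _; apply: is_derive_dir; exact: is_derive_sin.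
  + by move=> v; do !apply: Ck_onM; do ?apply: Ck_on_cst; try exact: openT.
Qed.

(** The derivative of the inverse is a polynomial in the inverse itself, so the induction hypothesis
    applies to it directly. *)
Lemma smooth_inv : smooth_on [set t : R | t != 0] (fun t => t^-1).
Proof.
have oN : open [set t : R | t != 0] by exact: open_neq.
have ci (t : R) : t != 0 -> {for t, continuous (fun t : R => t^-1)}.
  by move=> t0; exact: inv_continuous.
elim=> [|k IH]; first by split.
apply: (@Ck_onS _ _ _ k _ _ (fun v t : R => -1 * (t^-1 * t^-1) * v)) => //.
  move=> t v t0; rewrite mulN1r; apply: is_derive_dir; exact: is_derive_inv.
by move=> v; do !apply: Ck_onM => //; exact: Ck_on_cst.
Qed.

End SmoothFunctions.

(** Continuity is asked only at points of [A]: the inverse flow is controlled only where [f] is. *)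
Lemma open_setI_preimage (T U : topologicalType) (g : T -> U) (A : set T)
    (B : set U) : open A -> (forall x, A x -> {for x, continuous g}) ->
  open B -> open (A `&` g @^-1` B).
Proof.
rewrite !openE => oA cg oB x [Ax Bx].
apply: filterI; first exact: oA.
by apply: (cg x Ax); exact: oB.
Qed.

Lemma local_primitive (R : realType) (E : set R) (f : R -> R) (c : R) :
  open E -> (forall x, E x -> {for x, continuous f}) -> E c ->
  exists F (B : set R), [/\ open B, B c, B `<=` E &
    forall x, B x -> is_derive x 1 F (f x)].
Proof.
move=> oE cf Ec.
have /nbhs_ballP[e /= e0 be] : nbhs c E by exact: open_nbhs_nbhs.
(* Halving the radius keeps the closed interval inside [E], so [f] is integrable on it; the
   fundamental theorem then applies at its interior points. *)
pose d := e / 2; have d0 : 0 < d by rewrite divr_gt0.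
have sub x : x \in `[c - d, c + d] -> E x.
  rewrite in_itv /= => /andP[lx ux]; apply: be; rewrite /ball /= distrC.
  by rewrite (le_lt_trans _ (_ : d < e)) // ?ler_distl ?lx // ltr_pdivrMr //
     ltr_pMr // ltr1n.
exists (fun x => \int[@lebesgue_measure R]_(t in [set` `[c - d, x]]) f t)%R.
exists [set` `]c - d, c + d[]; split.
- exact: itv_open.
- by rewrite /= in_itv /= ltrBlDr ltrDl d0.
- by move=> x /= xI; apply: sub; exact: subset_itv_oo_cc.
move=> x /=; rewrite in_itv /= => /andP[lx ux].
have fint : (@lebesgue_measure R).-integrable `[c - d, c + d] (EFin \o f).
  apply: continuous_compact_integrable; first exact: segment_compact.
  by apply: continuous_in_subspaceT => y; rewrite inE => /= /sub; exact: cf.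
have [|dF F'] := continuous_FTC1_closed ux fint lx.
  by apply: cf; apply: sub; rewrite in_itv /= !ltW.
by apply: DeriveDef; [exact: dF | rewrite -derive1E].
Qed.

(** * Fields on space-time *)

(** Written with scalar coefficients on fixed vectors, so that differentiation and smoothness of a
    planar field reduce to its two components. *)
Definition vec2 (R : realType) (a b : R) : 'rV[R]_2 :=
  a *: basis2 R 0 + b *: basis2 R 1.

Lemma vec2_0 (R : realType) (a b : R) : vec2 a b 0 0 = a.
Proof. by rewrite !mxE /= mulr1 mulr0 addr0. Qed.

Lemma vec2_1 (R : realType) (a b : R) : vec2 a b 0 1 = b.
Proof. by rewrite !mxE /= mulr1 mulr0 add0r. Qed.

Lemma ord2P (P : 'I_2 -> Prop) : P 0 -> P 1 -> forall i, P i.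
Proof.
move=> P0 P1 [[|[|i]] ilt] //.
- by rewrite (_ : Ordinal ilt = 0) //; exact: val_inj.
- by rewrite (_ : Ordinal ilt = 1) //; exact: val_inj.
Qed.

Lemma vec2K (R : realType) (x : 'rV[R]_2) : vec2 (x 0 0) (x 0 1) = x.
Proof.
apply/rowP; apply: ord2P; [exact: vec2_0 | exact: vec2_1].
Qed.

Lemma vec2_inj (R : realType) (x y : 'rV[R]_2) :
  x 0 0 = y 0 0 -> x 0 1 = y 0 1 -> x = y.
Proof. by move=> e0 e1; rewrite -[x]vec2K e0 e1 vec2K. Qed.

Section Slices.
Context {R : realType} (W : normedModType R).
Local Notation spt := ('rV[R]_2 * R)%type.
Implicit Types (g : spt -> W) (x xi : 'rV[R]_2) (t tau : R).

Lemma is_derive_vec2 (V : normedModType R) (a b : V -> R) (x v : V) da db :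
  is_derive x v a da -> is_derive x v b db ->
  is_derive x v (fun y => vec2 (a y) (b y)) (vec2 da db).
Proof. by move=> ax bx; apply: is_derive_add; exact: is_derive_scale. Qed.

Lemma smooth_vec2 (V : normedModType R) (U : set V) (a b : V -> R) : open U ->
  smooth_on U a -> smooth_on U b -> smooth_on U (fun y => vec2 (a y) (b y)).
Proof. by move=> oU sa sb; apply: smooth_add => //; exact: smooth_scale. Qed.

(** The two difference quotients are the same function of [h], because a direction with zero time
    component does not move [t]. No joint differentiability is involved. *)
Lemma is_derive_slice_space g x t xi dg :
  is_derive (x, t) (xi, 0 : R) g dg -> is_derive x xi (fun y => g (y, t)) dg.
Proof.
suff E : (fun h : R => h^-1 *: ((g \o shift (x, t)) (h *: (xi, 0 : R)) - g (x, t))) =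
  (fun h => h^-1 *: (((fun y => g (y, t)) \o shift x) (h *: xi) - g (x, t))).
  by case=> dx dE; apply: DeriveDef; [rewrite /derivable -E | rewrite /derive -E].
apply/funext => h; rewrite /= /shift /=.
by rewrite -[(_, _) + (_, _)]/(h *: xi + x, h *: (0 : R) + t) scaler0 add0r.
Qed.

Lemma is_derive_slice_time g x t dg :
  is_derive (x, t) (0 : 'rV[R]_2, 1 : R) g dg ->
  is_derive t 1 (fun s => g (x, s)) dg.
Proof.
suff E : (fun h : R => h^-1 *: ((g \o shift (x, t)) (h *: (0 : 'rV[R]_2, 1 : R)) - g (x, t))) =
  (fun h => h^-1 *: (((fun s => g (x, s)) \o shift t) (h *: 1) - g (x, t))).
  by case=> dx dE; apply: DeriveDef; [rewrite /derivable -E | rewrite /derive -E].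
apply/funext => h; rewrite /= /shift /=.
by rewrite -[(_, _) + (_, _)]/(h *: (0 : 'rV[R]_2) + x, h *: (1 : R) + t) scaler0 add0r.
Qed.

Lemma is_derive_coord (q v : spt) (j : 'I_2) :
  is_derive q v (fun p : spt => p.1 0 j) (v.1 0 j).
Proof.
apply: (@is_derive_additive _ _ _ (fun p : spt => p.1 0 j)) => h.
by rewrite /= !mxE.
Qed.

Lemma is_derive_time (g : R -> R) dg (q v : spt) :
  is_derive q.2 1 g dg -> is_derive q v (fun p : spt => g p.2) (dg * v.2).
Proof.
by apply: is_derive_comp; apply: (@is_derive_additive _ _ _ snd).
Qed.

Lemma smooth_coord (U : set spt) (j : 'I_2) :
  open U -> smooth_on U (fun p : spt => p.1 0 j).
Proof.
move=> oU; apply: smooth_linear => // [q|h v x]; last by rewrite /= !mxE.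
apply: (@continuous_comp _ _ _ fst (fun x : 'rV[R]_2 => x 0 j)).
  exact: cvg_fst.
exact: coord_continuous.
Qed.

Lemma smooth_time (U : set spt) (I : set R) (g : R -> R) : open U ->
  (forall q, U q -> I q.2) -> smooth_on I g ->
  smooth_on U (fun p : spt => g p.2).
Proof.
move=> oU UI sg; apply: smooth_comp UI sg _ => //.
by apply: smooth_linear => // q; exact: cvg_snd.
Qed.

End Slices.

Section Fields.
Context {R : realType}.
Variables (r theta a1 a2 f F : R -> R).
Local Notation spt := ('rV[R]_2 * R)%type.
Implicit Types q v : spt.

(* [frame1], [frame2] are the components of M(-theta) x: this is R v(z) in terms
   of the Eulerian variables. [label] is the inverse of the flow map at a
   fixed time. *)
Definition frame1 q := cos (theta q.2) * q.1 0 0 + sin (theta q.2) * q.1 0 1.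
Definition frame2 q := - sin (theta q.2) * q.1 0 0 + cos (theta q.2) * q.1 0 1.
Definition label2 q := r q.2 * frame2 q.
Definition label1 q :=
  frame1 q * (r q.2)^-1 - a1 q.2 * label2 q - a2 q.2 * f (label2 q).
Definition label q := vec2 (label1 q) (label2 q).

Definition strain q := derive1 r q.2 * (r q.2)^-1.
(* The velocity in the rotating frame, that is R' v(z) rewritten using the
   equations for a1' and a2'. *)
Definition slip1 q := strain q * frame1 q
  + 2 * derive1 theta q.2 * frame2 q - f (label2 q) * (r q.2)^-1.
Definition slip2 q := - (strain q * frame2 q).
(** Differentiating x = M(theta) w in time gives a rigid rotation theta' (-x_2, x_1) plus M(theta)
    applied to w', which is the slip. *)
Definition velocity1 q := - (derive1 theta q.2 * q.1 0 1)
  + (cos (theta q.2) * slip1 q - sin (theta q.2) * slip2 q).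
Definition velocity2 q := derive1 theta q.2 * q.1 0 0
  + (sin (theta q.2) * slip1 q + cos (theta q.2) * slip2 q).
Definition velocity q := vec2 (velocity1 q) (velocity2 q).

(* In the rotating frame the acceleration is the symmetric matrix
   (pressure11, pressure12; pressure12, pressure22) applied to
   (frame1, frame2), plus (0, - 2 theta' f(z_2) / r); hence it is a gradient. *)
Definition pressure11 t := derive1 (derive1 r) t * (r t)^-1 - derive1 theta t * derive1 theta t.
Definition pressure12 t := derive1 (derive1 theta) t
  + 2 * derive1 theta t * (derive1 r t * (r t)^-1).
Definition pressure22 t := 3 * (derive1 theta t * derive1 theta t)
  + 2 * (derive1 r t * (r t)^-1) * (derive1 r t * (r t)^-1)
  - derive1 (derive1 r) t * (r t)^-1.
Definition pressure q :=
  - (2^-1 * pressure11 q.2 * (frame1 q * frame1 q)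
     + pressure12 q.2 * (frame1 q * frame2 q)
     + 2^-1 * pressure22 q.2 * (frame2 q * frame2 q))
  + 2 * derive1 theta q.2 * ((r q.2)^-1 * (r q.2)^-1) * F (label2 q).

Variables (I E : set R).
Hypotheses (I_open : open I) (E_open : open E).
Hypotheses (r_smooth : smooth_on I r) (theta_smooth : smooth_on I theta)
  (a1_smooth : smooth_on I a1) (a2_smooth : smooth_on I a2)
  (f_smooth : smooth_on E f) (F_smooth : smooth_on E F).
Hypothesis r_neq0 : forall t, I t -> r t != 0.
Hypothesis F_prim : forall x, E x -> is_derive x 1 F (f x).

(** From here on, [v.1] is the spatial and [v.2] the time component of the direction. The formulas
    are kept linear in [v], and all quantities other than [v] are evaluated at [q]. *)
Definition dframe1 q v :=
  v.2 * derive1 theta q.2 * frame2 q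
  + (cos (theta q.2) * v.1 0 0 + sin (theta q.2) * v.1 0 1).
Definition dframe2 q v :=
  - (v.2 * derive1 theta q.2 * frame1 q)
  + (- sin (theta q.2) * v.1 0 0 + cos (theta q.2) * v.1 0 1).
Definition dlabel2 q v :=
  derive1 r q.2 * v.2 * frame2 q + r q.2 * dframe2 q v.
Definition dstrain q v := v.2 * (derive1 (derive1 r) q.2 * (r q.2)^-1
  - derive1 r q.2 * derive1 r q.2 * ((r q.2)^-1 * (r q.2)^-1)).
Definition dslip1 q v :=
  dstrain q v * frame1 q + strain q * dframe1 q v
  + 2 * (derive1 (derive1 theta) q.2 * v.2 * frame2 q
         + derive1 theta q.2 * dframe2 q v)
  - (derive1 f (label2 q) * dlabel2 q v * (r q.2)^-1
     - f (label2 q) * derive1 r q.2 * v.2 * ((r q.2)^-1 * (r q.2)^-1)).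
Definition dslip2 q v := - (dstrain q v * frame2 q + strain q * dframe2 q v).
Definition dvelocity1 q v :=
  - (derive1 (derive1 theta) q.2 * v.2 * q.1 0 1 + derive1 theta q.2 * v.1 0 1)
  + (derive1 theta q.2 * v.2 * (- sin (theta q.2) * slip1 q - cos (theta q.2) * slip2 q)
     + (cos (theta q.2) * dslip1 q v - sin (theta q.2) * dslip2 q v)).
Definition dvelocity2 q v :=
  derive1 (derive1 theta) q.2 * v.2 * q.1 0 0 + derive1 theta q.2 * v.1 0 0
  + (derive1 theta q.2 * v.2 * (cos (theta q.2) * slip1 q - sin (theta q.2) * slip2 q)
     + (sin (theta q.2) * dslip1 q v + cos (theta q.2) * dslip2 q v)).
(* Only the value in spatial directions ([v.2 = 0]) is the derivative of
   [pressure]: the time derivatives of the coefficients are left out. *)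
Definition dpressure q v :=
  - (pressure11 q.2 * frame1 q * dframe1 q v
     + pressure12 q.2 * (frame1 q * dframe2 q v + frame2 q * dframe1 q v)
     + pressure22 q.2 * frame2 q * dframe2 q v)
  + 2 * derive1 theta q.2 * ((r q.2)^-1 * (r q.2)^-1)
      * f (label2 q) * dlabel2 q v.

(** [f] and [F] are evaluated at [label2 q] and are controlled only on [E]. When the pressure is
    built, [E] becomes a small set around one value of z_2. *)
Definition domain : set spt := [set q | I q.2] `&` label2 @^-1` E.

Let drv_r t : I t -> is_derive t 1 r (derive1 r t).
Proof. exact: smooth_is_derive. Qed.
Let drv_r1 t : I t -> is_derive t 1 (derive1 r) (derive1 (derive1 r) t).
Proof. by move=> It; apply: smooth_is_derive It; exact: smooth_derive1. Qed.
Let drv_th t : I t -> is_derive t 1 theta (derive1 theta t).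
Proof. exact: smooth_is_derive. Qed.
Let drv_th1 t : I t -> is_derive t 1 (derive1 theta) (derive1 (derive1 theta) t).
Proof. by move=> It; apply: smooth_is_derive It; exact: smooth_derive1. Qed.

(** * Directional derivatives of the explicit fields *)

Lemma is_derive_cos_theta q v : I q.2 ->
  is_derive q v (fun p : spt => cos (theta p.2))
    (- sin (theta q.2) * (derive1 theta q.2 * v.2)).
Proof.
move=> Iq; apply: is_derive_comp (is_derive_cos _).
by apply: is_derive_time; exact: drv_th.
Qed.

Lemma is_derive_sin_theta q v : I q.2 ->
  is_derive q v (fun p : spt => sin (theta p.2))
    (cos (theta q.2) * (derive1 theta q.2 * v.2)).
Proof.
move=> Iq; apply: is_derive_comp (is_derive_sin _).
by apply: is_derive_time; exact: drv_th.
Qed.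

Lemma is_derive_inv_r q v : I q.2 ->
  is_derive q v (fun p : spt => (r p.2)^-1)
    (- ((r q.2)^-1 * (r q.2)^-1) * (derive1 r q.2 * v.2)).
Proof.
move=> Iq; apply: (@is_derive_comp _ _ (fun s : R => s^-1) (fun p : spt => r p.2)).
  by apply: is_derive_time; exact: drv_r.
by apply: is_derive_inv; exact: r_neq0.
Qed.

Lemma is_derive_frame1 q v : I q.2 -> is_derive q v frame1 (dframe1 q v).
Proof.
move=> Iq; apply: is_derive_eq.
  apply: is_derive_add; apply: is_derive_mul (is_derive_coord _ _ _).
    exact: is_derive_cos_theta.
  exact: is_derive_sin_theta.
rewrite /dframe1 /frame2; ring.
Qed.

Lemma is_derive_frame2 q v : I q.2 -> is_derive q v frame2 (dframe2 q v).
Proof.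
move=> Iq; apply: is_derive_eq.
  apply: is_derive_add; apply: is_derive_mul (is_derive_coord _ _ _).
    by apply: is_derive_opp; exact: is_derive_sin_theta.
  exact: is_derive_cos_theta.
rewrite /dframe2 /frame1; ring.
Qed.

Lemma is_derive_label2 q v : I q.2 -> is_derive q v label2 (dlabel2 q v).
Proof.
move=> Iq; apply: is_derive_eq.
  apply: is_derive_mul (is_derive_frame2 _ Iq).
  by apply: is_derive_time; exact: drv_r.
rewrite /dlabel2; ring.
Qed.

Lemma is_derive_strain q v : I q.2 -> is_derive q v strain (dstrain q v).
Proof.
move=> Iq; apply: is_derive_eq.
  apply: is_derive_mul (is_derive_inv_r _ Iq).
  by apply: is_derive_time; exact: drv_r1.
rewrite /dstrain; ring.
Qed.

Lemma is_derive_slip1 q v : domain q -> is_derive q v slip1 (dslip1 q v).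
Proof.
move=> [Iq Eq]; apply: is_derive_eq.
  apply: is_derive_add; last first.
    apply: is_derive_opp; apply: is_derive_mul (is_derive_inv_r _ Iq).
    apply: is_derive_comp (is_derive_label2 _ Iq) _.
    exact: smooth_is_derive f_smooth Eq.
  apply: is_derive_add.
    exact: is_derive_mul (is_derive_strain _ Iq) (is_derive_frame1 _ Iq).
  apply: is_derive_mul (is_derive_frame2 _ Iq).
  apply: is_derive_mul.
  by apply: is_derive_time; exact: drv_th1.
rewrite /dslip1; ring.
Qed.

Lemma is_derive_slip2 q v : I q.2 -> is_derive q v slip2 (dslip2 q v).
Proof.
move=> Iq; apply: is_derive_eq.
  apply: is_derive_opp.
  exact: is_derive_mul (is_derive_strain _ Iq) (is_derive_frame2 _ Iq).
rewrite /dslip2; ring.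
Qed.

Lemma is_derive_velocity1 q v :
  domain q -> is_derive q v velocity1 (dvelocity1 q v).
Proof.
move=> dq; have Iq := dq.1; apply: is_derive_eq.
  apply: is_derive_add.
    apply: is_derive_opp; apply: is_derive_mul (is_derive_coord _ _ _).
    by apply: is_derive_time; exact: drv_th1.
  apply: is_derive_add.
    exact: is_derive_mul (is_derive_cos_theta _ Iq) (is_derive_slip1 _ dq).
  apply: is_derive_opp.
  exact: is_derive_mul (is_derive_sin_theta _ Iq) (is_derive_slip2 _ Iq).
rewrite /dvelocity1; ring.
Qed.

Lemma is_derive_velocity2 q v :
  domain q -> is_derive q v velocity2 (dvelocity2 q v).
Proof.
move=> dq; have Iq := dq.1; apply: is_derive_eq.
  apply: is_derive_add.
    apply: is_derive_mul (is_derive_coord _ _ _).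
    by apply: is_derive_time; exact: drv_th1.
  apply: is_derive_add.
    exact: is_derive_mul (is_derive_sin_theta _ Iq) (is_derive_slip1 _ dq).
  exact: is_derive_mul (is_derive_cos_theta _ Iq) (is_derive_slip2 _ Iq).
rewrite /dvelocity2; ring.
Qed.

(** With [t] frozen the coefficients are constants, so r'' and theta'' are not differentiated again;
    the Euler equations need only the spatial gradient. *)
Lemma is_derive_pressure (x xi : 'rV[R]_2) (t : R) : domain (x, t) ->
  is_derive x xi (fun y => pressure (y, t)) (dpressure (x, t) (xi, 0)).
Proof.
move=> [It Et].
have D1 : is_derive x xi (fun y => frame1 (y, t)) (dframe1 (x, t) (xi, 0)).
  by apply: is_derive_slice_space; exact: is_derive_frame1.
have D2 : is_derive x xi (fun y => frame2 (y, t)) (dframe2 (x, t) (xi, 0)).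
  by apply: is_derive_slice_space; exact: is_derive_frame2.
have DF : is_derive x xi (fun y => F (label2 (y, t)))
    (f (label2 (x, t)) * dlabel2 (x, t) (xi, 0)).
  apply: (@is_derive_slice_space _ _ (fun q => F (label2 q))).
  apply: is_derive_comp (is_derive_label2 _ It) _; exact: F_prim.
have DC (a : R) : is_derive x xi (fun=> a) 0 by exact: is_derive_const.
rewrite /pressure /=.
refine (is_derive_eq (is_derive_add (is_derive_opp (is_derive_add (is_derive_add
  (is_derive_mul (DC _) (is_derive_mul D1 D1))
  (is_derive_mul (DC _) (is_derive_mul D1 D2)))
  (is_derive_mul (DC _) (is_derive_mul D2 D2)))) (is_derive_mul (DC _) DF)) _).
rewrite /dpressure /=; field; exact: r_neq0.
Qed.

(** * Divergence, curl and momentum balance as algebraic identities *)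

Lemma divergence_free q : I q.2 ->
  dvelocity1 q (basis2 R 0, 0) + dvelocity2 q (basis2 R 1, 0) = 0.
Proof.
move=> Iq; have r0 := r_neq0 Iq.
rewrite /dvelocity1 /dvelocity2 /dslip1 /dslip2 /dlabel2 /dframe1 /dframe2.
rewrite /dstrain /basis2 !mxE /=.
move: (f _) (derive1 f _) (frame1 q) (frame2 q) => fz dfz w1 w2.
move: (slip1 q) (slip2 q) (strain q) => U1 U2 k.
move: (derive1 (derive1 theta) q.2) (derive1 (derive1 r) q.2) (derive1 theta q.2).
move: (derive1 r q.2) (q.1 0 0) (q.1 0 1) (cos _) (sin _) (r q.2) r0.
by move=> *; field.
Qed.

(** In the frame, the gradient of the slip has rows (strain, 2 theta' - f') and (0, -strain). Its
    zero trace gives [divergence_free]; its off-diagonal entry contributes f' - 2 theta' to the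
    curl, and the rigid rotation contributes 2 theta'. *)
Lemma curl_velocity q : I q.2 ->
  dvelocity2 q (basis2 R 0, 0) - dvelocity1 q (basis2 R 1, 0)
    = derive1 f (label2 q).
Proof.
move=> Iq; have r0 := r_neq0 Iq.
(* This form isolates the one use of cos^2 + sin^2 = 1: the slip part of the curl carries that
   factor, the rigid part does not. Up to here cosine and sine are free symbols. *)
transitivity (2 * derive1 theta q.2 - (2 * derive1 theta q.2
    - derive1 f (label2 q)) * (cos (theta q.2) ^+ 2 + sin (theta q.2) ^+ 2)).
  rewrite /dvelocity1 /dvelocity2 /dslip1 /dslip2 /dlabel2 /dframe1 /dframe2.
  rewrite /dstrain /basis2 !mxE /=.
  move: (f _) (derive1 f _) (frame1 q) (frame2 q) => fz dfz w1 w2.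
  move: (slip1 q) (slip2 q) (strain q) => U1 U2 k.
  move: (derive1 (derive1 theta) q.2) (derive1 (derive1 r) q.2) (derive1 theta q.2).
  move: (derive1 r q.2) (q.1 0 0) (q.1 0 1) (cos _) (sin _) (r q.2) r0.
  by move=> *; field.
by rewrite cos2Dsin2; ring.
Qed.

Lemma frame_coord1 q :
  q.1 0 0 = cos (theta q.2) * frame1 q - sin (theta q.2) * frame2 q.
Proof.
(* The Pythagorean identity is inserted as a factor 1 on one side, after which the equality is
   purely polynomial. *)
rewrite /frame1 /frame2 -[LHS]mul1r -(cos2Dsin2 (theta q.2)); ring.
Qed.

Lemma frame_coord2 q :
  q.1 0 1 = sin (theta q.2) * frame1 q + cos (theta q.2) * frame2 q.
Proof.
rewrite /frame1 /frame2 -[LHS]mul1r -(cos2Dsin2 (theta q.2)); ring.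
Qed.

(** Along a particle path the rigid part of the velocity cancels the turning of the frame, and only
    the slip remains. *)
Lemma dframe1_material q : dframe1 q (velocity q, 1) = slip1 q.
Proof.
rewrite /dframe1 /= mul1r vec2_0 vec2_1 /velocity1 /velocity2 -[RHS]mul1r.
rewrite -(cos2Dsin2 (theta q.2)) /frame2; ring.
Qed.

Lemma dframe2_material q : dframe2 q (velocity q, 1) = slip2 q.
Proof.
rewrite /dframe2 /= mul1r vec2_0 vec2_1 /velocity1 /velocity2 -[RHS]mul1r.
rewrite -(cos2Dsin2 (theta q.2)) /frame1; ring.
Qed.

(** Particles keep their label z_2: the growth of [r] offsets the contraction -r'/r of the second
    frame component. *)
Lemma dlabel2_material q : I q.2 -> dlabel2 q (velocity q, 1) = 0.
Proof.
move=> Iq; have r0 := r_neq0 Iq.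
by rewrite /dlabel2 dframe2_material /slip2 /strain /=; field.
Qed.

(** The direction [(velocity q, 1)] is [(0, 1)] plus the combination of the basis directions with
    the velocity components as coefficients, so the Eulerian acceleration is a single derivative
    along the path. *)
Lemma dvelocity1_linear q :
  dvelocity1 q (0, 1) + (velocity1 q * dvelocity1 q (basis2 R 0, 0)
     + velocity2 q * dvelocity1 q (basis2 R 1, 0))
  = dvelocity1 q (velocity q, 1).
Proof.
rewrite /dvelocity1 /dslip1 /dslip2 /dlabel2 /dframe1 /dframe2 /dstrain.
rewrite /basis2 /= !vec2_0 !vec2_1 !mxE /=.
move: (velocity1 q) (velocity2 q) (slip1 q) (slip2 q) (strain q) => u1 u2 U1 U2 k.
move: (f _) (derive1 f _) (frame1 q) (frame2 q) => fz dfz w1 w2.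
move: (derive1 (derive1 theta) q.2) (derive1 (derive1 r) q.2) (derive1 theta q.2).
move: (derive1 r q.2) (q.1 0 0) (q.1 0 1) (cos _) (sin _) (r q.2).
by move=> *; ring.
Qed.

Lemma dvelocity2_linear q :
  dvelocity2 q (0, 1) + (velocity1 q * dvelocity2 q (basis2 R 0, 0)
     + velocity2 q * dvelocity2 q (basis2 R 1, 0))
  = dvelocity2 q (velocity q, 1).
Proof.
rewrite /dvelocity2 /dslip1 /dslip2 /dlabel2 /dframe1 /dframe2 /dstrain.
rewrite /basis2 /= !vec2_0 !vec2_1 !mxE /=.
move: (velocity1 q) (velocity2 q) (slip1 q) (slip2 q) (strain q) => u1 u2 U1 U2 k.
move: (f _) (derive1 f _) (frame1 q) (frame2 q) => fz dfz w1 w2.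
move: (derive1 (derive1 theta) q.2) (derive1 (derive1 r) q.2) (derive1 theta q.2).
move: (derive1 r q.2) (q.1 0 0) (q.1 0 1) (cos _) (sin _) (r q.2).
by move=> *; ring.
Qed.

(** Once positions and path derivatives are expressed in the frame, both terms are linear in cos
    theta and sin theta, whose coefficients are, up to sign, the two frame components of the
    momentum equation. Each vanishes separately, so no trigonometric identity remains to be used. *)
Lemma momentum1 q : I q.2 ->
  dvelocity1 q (velocity q, 1) + dpressure q (basis2 R 0, 0) = 0.
Proof.
move=> Iq; have r0 := r_neq0 Iq.
rewrite /dvelocity1 /dslip1 /dslip2 dframe1_material dframe2_material.
rewrite dlabel2_material // /= vec2_1 /velocity2 frame_coord1 frame_coord2.
rewrite /dpressure /dlabel2 /dframe1 /dframe2 /basis2 !mxE /=.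
rewrite /slip1 /slip2 /dstrain /strain /pressure11 /pressure12 /pressure22 /=.
move: (f _) (derive1 f _) (frame1 q) (frame2 q) => fz dfz w1 w2.
move: (derive1 (derive1 theta) q.2) (derive1 (derive1 r) q.2) (derive1 theta q.2).
move: (derive1 r q.2) (q.1 0 0) (q.1 0 1) (cos _) (sin _) (r q.2) r0.
by move=> *; field.
Qed.

Lemma momentum2 q : I q.2 ->
  dvelocity2 q (velocity q, 1) + dpressure q (basis2 R 1, 0) = 0.
Proof.
move=> Iq; have r0 := r_neq0 Iq.
rewrite /dvelocity2 /dslip1 /dslip2 dframe1_material dframe2_material.
rewrite dlabel2_material // /= vec2_0 /velocity1 frame_coord1 frame_coord2.
rewrite /dpressure /dlabel2 /dframe1 /dframe2 /basis2 !mxE /=.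
rewrite /slip1 /slip2 /dstrain /strain /pressure11 /pressure12 /pressure22 /=.
move: (f _) (derive1 f _) (frame1 q) (frame2 q) => fz dfz w1 w2.
move: (derive1 (derive1 theta) q.2) (derive1 (derive1 r) q.2) (derive1 theta q.2).
move: (derive1 r q.2) (q.1 0 0) (q.1 0 1) (cos _) (sin _) (r q.2) r0.
by move=> *; field.
Qed.

(** * Smoothness of the explicit fields on their domain *)

Lemma open_times : open [set q : spt | I q.2].
Proof. by apply: (@open_comp spt R snd) => // q _; exact: cvg_snd. Qed.

Let timeI (U : set spt) : open U -> (forall q, U q -> I q.2) ->
  forall g : R -> R, smooth_on I g -> smooth_on U (fun q => g q.2).
Proof. by move=> oU UI g; exact: smooth_time UI. Qed.

Lemma smooth_cos_theta (U : set spt) : open U -> (forall q, U q -> I q.2) ->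
  smooth_on U (fun q => cos (theta q.2)).
Proof.
by move=> oU UI; apply: smooth_comp (smooth_trig.1) _ => //; exact: timeI.
Qed.

Lemma smooth_sin_theta (U : set spt) : open U -> (forall q, U q -> I q.2) ->
  smooth_on U (fun q => sin (theta q.2)).
Proof.
by move=> oU UI; apply: smooth_comp (smooth_trig.2) _ => //; exact: timeI.
Qed.

Lemma smooth_inv_r : smooth_on I (fun t => (r t)^-1).
Proof.
apply: smooth_comp smooth_inv _ => //; exact: r_neq0.
Qed.

Lemma smooth_frame1 (U : set spt) : open U -> (forall q, U q -> I q.2) ->
  smooth_on U frame1.
Proof.
move=> oU UI; apply: smooth_add => //; apply: smooth_mul => //;
  do ?exact: smooth_coord.
- exact: smooth_cos_theta.
- exact: smooth_sin_theta.
Qed.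

Lemma smooth_frame2 (U : set spt) : open U -> (forall q, U q -> I q.2) ->
  smooth_on U frame2.
Proof.
move=> oU UI; apply: smooth_add => //; apply: smooth_mul => //;
  do ?exact: smooth_coord.
- by apply: smooth_opp => //; exact: smooth_sin_theta.
- exact: smooth_cos_theta.
Qed.

Lemma smooth_label2 (U : set spt) : open U -> (forall q, U q -> I q.2) ->
  smooth_on U label2.
Proof.
move=> oU UI; apply: smooth_mul => //; [exact: timeI | exact: smooth_frame2].
Qed.

Lemma open_domain : open domain.
Proof.
apply: open_setI_preimage => //; first exact: open_times.
by apply: smooth_continuous; apply: smooth_label2 => //; exact: open_times.
Qed.

Let domI q : domain q -> I q.2. Proof. by case. Qed.
Let domE q : domain q -> E (label2 q). Proof. by case. Qed.

Lemma smooth_label1 : smooth_on domain label1.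
Proof.
have oU := open_domain; have tI := timeI oU domI.
apply: smooth_add => //; first apply: smooth_add => //.
- apply: smooth_mul => //; first exact: smooth_frame1.
  exact: (tI _ smooth_inv_r).
- apply: smooth_opp => //; apply: smooth_mul => //; first exact: tI.
  exact: smooth_label2.
- apply: smooth_opp => //; apply: smooth_mul => //; first exact: tI.
  by apply: (smooth_comp oU domE _ (smooth_label2 oU domI)).
Qed.

Lemma smooth_label : smooth_on domain label.
Proof.
have oU := open_domain; apply: smooth_vec2 => //; first exact: smooth_label1.
exact: smooth_label2.
Qed.

Lemma smooth_strain : smooth_on domain strain.
Proof.
have oU := open_domain; have tI := timeI oU domI.
apply: smooth_mul => //; last exact: (tI _ smooth_inv_r).
by apply: (tI (derive1 _)); exact: smooth_derive1.
Qed.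

Lemma smooth_slip1 : smooth_on domain slip1.
Proof.
have oU := open_domain; have tI := timeI oU domI.
apply: smooth_add => //; first apply: smooth_add => //.
- by apply: smooth_mul => //; [exact: smooth_strain | exact: smooth_frame1].
- apply: smooth_mul => //; last exact: smooth_frame2.
  apply: smooth_mul => //; first exact: smooth_cst.
  by apply: (tI (derive1 _)); exact: smooth_derive1.
- apply: smooth_opp => //; apply: smooth_mul => //.
    by apply: (smooth_comp oU domE _ (smooth_label2 oU domI)).
  exact: (tI _ smooth_inv_r).
Qed.

Lemma smooth_slip2 : smooth_on domain slip2.
Proof.
have oU := open_domain; apply: smooth_opp => //; apply: smooth_mul => //.
  exact: smooth_strain.
exact: smooth_frame2.
Qed.

Lemma smooth_velocity : smooth_on domain velocity.
Proof.
have oU := open_domain; have tI := timeI oU domI.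
have sth : smooth_on domain (fun q => derive1 theta q.2).
  by apply: (tI (derive1 _)); exact: smooth_derive1.
have sc := smooth_cos_theta oU domI; have ss := smooth_sin_theta oU domI.
have s1 := smooth_slip1; have s2 := smooth_slip2.
apply: smooth_vec2 => //; apply: smooth_add => //.
- apply: smooth_opp => //; apply: smooth_mul => //; exact: smooth_coord.
- apply: smooth_add => //; first exact: smooth_mul.
  by apply: smooth_opp => //; exact: smooth_mul.
- apply: smooth_mul => //; exact: smooth_coord.
- by apply: smooth_add => //; exact: smooth_mul.
Qed.

Lemma smooth_pressure : smooth_on domain pressure.
Proof.
have oU := open_domain; have tI := timeI oU domI.
have s1 := smooth_frame1 oU domI; have s2 := smooth_frame2 oU domI.
have sth : smooth_on I (derive1 theta) by exact: smooth_derive1.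
have sr := smooth_inv_r.
have sk : smooth_on I (fun t => derive1 r t * (r t)^-1).
  by apply: smooth_mul => //; exact: smooth_derive1.
have sdd : smooth_on I (fun t => derive1 (derive1 r) t * (r t)^-1).
  by apply: smooth_mul => //; do 2!apply: smooth_derive1.
have sth2 : smooth_on I (fun t => derive1 theta t * derive1 theta t).
  exact: smooth_mul.
have cI (a : R) : smooth_on I (fun=> a) by exact: smooth_cst.
have p11 : smooth_on I pressure11.
  by apply: smooth_add => //; apply: smooth_opp.
have p12 : smooth_on I pressure12.
  apply: smooth_add => //; first by do 2!apply: smooth_derive1.
  by apply: smooth_mul => //; exact: smooth_mul.
have p22 : smooth_on I pressure22.
  apply: smooth_add => //; last exact: smooth_opp.
  apply: smooth_add => //; first exact: smooth_mul.
  by apply: smooth_mul => //; exact: smooth_mul.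
have cU (a : R) : smooth_on domain (fun=> a) by exact: smooth_cst.
apply: smooth_add => //.
  apply: smooth_opp => //; apply: smooth_add => //; first apply: smooth_add => //.
  - by apply: smooth_mul (smooth_mul oU s1 s1) => //; exact: smooth_mul (tI _ p11).
  - exact: smooth_mul (tI _ p12) (smooth_mul oU s1 s2).
  - by apply: smooth_mul (smooth_mul oU s2 s2) => //; exact: smooth_mul (tI _ p22).
apply: smooth_mul => //; last first.
  by apply: (smooth_comp oU domE _ (smooth_label2 oU domI)).
apply: smooth_mul => //; first exact: smooth_mul (tI _ sth).
exact: smooth_mul (tI _ sr) (tI _ sr).
Qed.

End Fields.

(** * The flow map and its inverse *)

Section FlowMap.
Context {R : realType}.
Variables (r theta a1 a2 f : R -> R).
Local Notation spt := ('rV[R]_2 * R)%type.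
Local Notation phi := (flow r theta a1 a2 f).

(** This is the first component of R v(z), that is [frame1] in the labels; the second component is
    z_2 / r. *)
Definition shear (z : 'rV[R]_2) t :=
  r t * (z 0 0 + a1 t * z 0 1 + a2 t * f (z 0 1)).

Lemma flowE z t : phi z t =
  vec2 (cos (theta t) * shear z t - sin (theta t) * ((r t)^-1 * z 0 1))
       (sin (theta t) * shear z t + cos (theta t) * ((r t)^-1 * z 0 1)).
Proof.
apply: vec2_inj; rewrite ?vec2_0 ?vec2_1 /flow /Amx /vvec /rotmx /Rmx /mx_of_rows;
  rewrite !mxE !big_ord_recl big_ord0 !mxE !big_ord_recl !big_ord0 !mxE /=;
  rewrite /shear; ring.
Qed.

Lemma frame1_flow z t : frame1 theta (phi z t, t) = shear z t.
Proof.
rewrite /frame1 flowE /= vec2_0 vec2_1 -[RHS]mul1r -(cos2Dsin2 (theta t)); ring.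
Qed.

Lemma frame2_flow z t : frame2 theta (phi z t, t) = (r t)^-1 * z 0 1.
Proof.
rewrite /frame2 flowE /= vec2_0 vec2_1 -[RHS]mul1r -(cos2Dsin2 (theta t)); ring.
Qed.

Lemma label2_flow z t : r t != 0 -> label2 r theta (phi z t, t) = z 0 1.
Proof. by move=> r0; rewrite /label2 frame2_flow /= mulrA divff ?mul1r. Qed.

Lemma label_flow z t : r t != 0 -> label r theta a1 a2 f (phi z t, t) = z.
Proof.
move=> r0; rewrite /label /label1 label2_flow // frame1_flow /shear /=.
apply: vec2_inj; rewrite ?vec2_0 ?vec2_1 //.
move: (f _) => fz; field; exact: r0.
Qed.

(** Only r != 0 matters for inverting the flow, since [f] is a total function; the set [E] enters
    only through smoothness. *)
Lemma flow_label q : r q.2 != 0 -> phi (label r theta a1 a2 f q) q.2 = q.1.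
Proof.
move=> r0; have e1 : shear (label r theta a1 a2 f q) q.2 = frame1 theta q.
  rewrite /shear /label vec2_0 vec2_1 /label1.
  move: (label2 _ _ _) (frame1 _ _) (f _) => z2 w1 fz; field; exact: r0.
have e2 : (r q.2)^-1 * label r theta a1 a2 f q 0 1 = frame2 theta q.
  by rewrite /label vec2_1 /label2 mulrA mulVf ?mul1r.
rewrite flowE e1 e2; apply: vec2_inj; rewrite ?vec2_0 ?vec2_1.
  by rewrite -frame_coord1.
by rewrite -frame_coord2.
Qed.

(** This is where the equations for a_1' and a_2' enter: [velocity] is defined without them, and its
    divergence, curl and momentum identities hold without them. *)
Lemma is_derive_flow_time z t dr dth da1 da2 :
  r t != 0 -> is_derive t 1 r dr -> is_derive t 1 theta dth ->
  is_derive t 1 a1 da1 -> is_derive t 1 a2 da2 ->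
  da1 = 2 * dth / r t ^+ 2 -> da2 = - (1 / r t ^+ 2) ->
  is_derive t 1 (phi z) (velocity r theta f (phi z t, t)).
Proof.
move=> r0 Dr Dth Da1 Da2 e1 e2.
have Drth : derive1 theta t = dth by rewrite derive1E; case: Dth.
have Drr : derive1 r t = dr by rewrite derive1E; case: Dr.
have Dc := is_derive_comp Dth (is_derive_cos (theta t)).
have Ds := is_derive_comp Dth (is_derive_sin (theta t)).
have Di := is_derive_comp Dr (is_derive_inv r0).
have DC (a : R) : is_derive t 1 (fun=> a) 0 by exact: is_derive_const.
have Dg : is_derive t 1 (shear z) (r t * (da1 * z 0 1 + da2 * f (z 0 1))
    + dr * (z 0 0 + a1 t * z 0 1 + a2 t * f (z 0 1))).
  refine (is_derive_eq (is_derive_mul Dr (is_derive_add (is_derive_add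
    (DC _) (is_derive_mul Da1 (DC _))) (is_derive_mul Da2 (DC _)))) _).
  ring.
have Dz := is_derive_mul Di (DC (z 0 1)).
set u := velocity _ _ _ _; rewrite (funext (flowE z)).
refine (is_derive_eq (is_derive_vec2
  (is_derive_add (is_derive_mul Dc Dg) (is_derive_opp (is_derive_mul Ds Dz)))
  (is_derive_add (is_derive_mul Ds Dg) (is_derive_mul Dc Dz))) _).
rewrite /u /velocity /velocity1 /velocity2 /slip1 /slip2 /strain.
rewrite frame1_flow frame2_flow label2_flow // flowE /= !vec2_0 !vec2_1.
rewrite Drth Drr e1 e2 /shear; apply: vec2_inj; rewrite ?vec2_0 ?vec2_1.
  move: (z 0 0) (z 0 1) (r t) r0 (f _) (cos _) (sin _) => z1 z2 rr r0 fz c s.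
  by field.
move: (z 0 0) (z 0 1) (r t) r0 (f _) (cos _) (sin _) => z1 z2 rr r0 fz c s.
by field.
Qed.

End FlowMap.

Lemma open_prod (T U : topologicalType) (A : set T) (B : set U) :
  open A -> open B -> open (A `*` B).
Proof.
move=> oA oB; rewrite (_ : A `*` B = fst @^-1` A `&` snd @^-1` B) //.
apply: openI; apply: open_comp => // q _; [exact: cvg_fst | exact: cvg_snd].
Qed.

Lemma det_mx2 (R : comPzRingType) (A : 'M[R]_2) :
  \det A = A 0 0 * A 1 1 - A 0 1 * A 1 0.
Proof.
rewrite (expand_det_row _ 0) !big_ord_recl big_ord0 /cofactor !det_mx11 !mxE /=.
rewrite expr0 expr1 addr0 mul1r mulN1r mulrN.
by congr (_ * A _ _ - A _ _ * A _ _); apply: val_inj.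
Qed.

Lemma sum_ord2 (V : nmodType) (g : 'I_2 -> V) : \sum_j g j = g 0 + g 1.
Proof.
rewrite !big_ord_recl big_ord0 addr0; congr (_ + g _); exact: val_inj.
Qed.

(** * Determinant, vorticity and local Euler solution of the flow *)

Section Main.
Context {R : realType}.
Variables (r theta a1 a2 f : R -> R) (I : set R) (D : set 'rV[R]_2) (E : set R).
Local Notation spt := ('rV[R]_2 * R)%type.
Local Notation phi := (flow r theta a1 a2 f).
Hypotheses (I_open : open I) (D_open : open D) (E_open : open E).
Hypotheses (r_smooth : smooth_on I r) (theta_smooth : smooth_on I theta)
  (a1_smooth : smooth_on I a1) (a2_smooth : smooth_on I a2)
  (f_smooth : smooth_on E f).
Hypothesis r_neq0 : forall t, I t -> r t != 0.
Hypothesis f_def : forall z, D z -> E (z 0 1).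
Hypothesis a1_eq : forall t, I t -> derive1 a1 t = 2 * derive1 theta t / r t ^+ 2.
Hypothesis a2_eq : forall t, I t -> derive1 a2 t = - (1 / r t ^+ 2).

Lemma flow_velocity z t : I t ->
  derive1 (phi z) t = velocity r theta f (phi z t, t).
Proof.
move=> It; have Dv (g : R -> R) : smooth_on I g -> is_derive t 1 g (derive1 g t).
  by move=> sg; exact: smooth_is_derive sg It.
have [_ <-] := is_derive_flow_time f z (r_neq0 It) (Dv _ r_smooth)
  (Dv _ theta_smooth) (Dv _ a1_smooth) (Dv _ a2_smooth) (a1_eq It) (a2_eq It).
by rewrite derive1E.
Qed.

(** The map z to R v(z) has a triangular Jacobian with diagonal (r, 1/r), and the rotation has
    determinant 1. *)
Lemma det_flow z t : D z -> I t -> \det (dz phi z t) = 1.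
Proof.
move=> Dz It; have r0 := r_neq0 It.
have df : is_derive (z 0 1) 1 f (derive1 f (z 0 1)).
  by apply: smooth_is_derive f_smooth _; exact: f_def.
(* The entries of [jacobian] are directional derivatives only for a Frechet differentiable map, so
   differentiability is established separately from the derivative formulas. *)
have diff : differentiable (fun y => phi y t) z.
  have dsh : differentiable (fun y => shear r a1 a2 f y t) z.
    apply: (@differentiableM _ _ (fun=> r t)) => //.
    apply: (@differentiableD _ _ _ (fun y : 'rV[R]_2 => y 0 0 + a1 t * y 0 1)
      (fun y : 'rV[R]_2 => a2 t * f (y 0 1))).
      apply: (@differentiableD _ _ _ (fun y : 'rV[R]_2 => y 0 0)
        (fun y : 'rV[R]_2 => a1 t * y 0 1)); first exact: differentiable_coord.
      by apply: (@differentiableM _ _ (fun=> a1 t)) => //; exact: differentiable_coord.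
    apply: (@differentiableM _ _ (fun=> a2 t)) => //.
    apply: (@differentiable_comp _ _ _ _ (fun y : 'rV[R]_2 => y 0 1) f).
      exact: differentiable_coord.
    by apply/derivable1_diffP; case: df.
  have d2 : differentiable (fun y : 'rV[R]_2 => (r t)^-1 * y 0 1) z.
    by apply: (@differentiableM _ _ (fun=> (r t)^-1)) => //; exact: differentiable_coord.
  rewrite (funext (fun y => flowE r theta a1 a2 f y t)).
  apply: differentiableD; apply: differentiableZl.
    by apply: differentiableB; apply: (@differentiableM _ _ (fun=> _)).
  by apply: differentiableD; apply: (@differentiableM _ _ (fun=> _)).
pose dsh (v : 'rV[R]_2) := r t * (v 0 0 + a1 t * v 0 1
  + a2 t * (derive1 f (z 0 1) * v 0 1)).
have dphi (v : 'rV[R]_2) : is_derive z v (fun y => phi y t)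
    (vec2 (cos (theta t) * dsh v - sin (theta t) * ((r t)^-1 * v 0 1))
          (sin (theta t) * dsh v + cos (theta t) * ((r t)^-1 * v 0 1))).
  have DC (a : R) : is_derive z v (fun=> a) 0 by exact: is_derive_const.
  have Dx j : is_derive z v (fun y : 'rV[R]_2 => y 0 j) (v 0 j).
    apply: (@is_derive_additive _ _ _ (fun y : 'rV[R]_2 => y 0 j)) => h.
    by rewrite !mxE.
  have Df := is_derive_comp (Dx 1) df.
  have Ds := is_derive_mul (DC (r t)) (is_derive_add (is_derive_add
    (Dx 0) (is_derive_mul (DC (a1 t)) (Dx 1))) (is_derive_mul (DC (a2 t)) Df)).
  have D2 := is_derive_mul (DC (r t)^-1) (Dx 1).
  rewrite (funext (fun y => flowE r theta a1 a2 f y t)).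
  refine (is_derive_eq (is_derive_vec2
   (is_derive_add (is_derive_mul (DC _) Ds) (is_derive_opp (is_derive_mul (DC _) D2)))
   (is_derive_add (is_derive_mul (DC _) Ds) (is_derive_mul (DC _) D2))) _).
  by rewrite /dsh !mulr0 !addr0.
have dzE i j : dz phi z t i j = 'D_(basis2 R j) (fun y => phi y t) z 0 i.
  by rewrite deriveEjacobian // /basis2 -rowE [RHS]mxE /dz [LHS]mxE.
rewrite det_mx2 !dzE.
have DE v := @derive_val _ _ _ _ _ _ _ (dphi v).
rewrite !DE !vec2_0 !vec2_1 /dsh /basis2 !mxE /=.
transitivity (cos (theta t) ^+ 2 + sin (theta t) ^+ 2); last exact: cos2Dsin2.
move: (derive1 f _) (cos _) (sin _) (r t) r0 => f1 c s rr r0; by field.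
Qed.

(** An arbitrary local velocity field agrees with [velocity] on the image of [W], both being the
    time derivative of the flow there. The image is open, so they agree near the point and have the
    same curl. *)
Lemma vorticity_flow : is_vorticity D I phi (fun z _ => derive1 f (z 0 1)).
Proof.
move=> W u [oW WDI _ oQ uE] z t Wzt; have [Dz It] := WDI _ Wzt.
have r0 := r_neq0 It; have l2 : label2 r theta (phi z t, t) = z 0 1.
  exact: label2_flow.
have dom : domain r theta I E (phi z t, t) by split; rewrite //= l2; exact: f_def.
have uV : \forall x \near phi z t, u x t = velocity r theta f (x, t).
  have Qzt : nbhs (phi z t, t) (spacetime phi @` W).
    by apply: open_nbhs_nbhs; split => //; exists (z, t).
  (* The open space-time image is cut at the fixed time [t] to obtain a neighbourhood in the
     plane. *)
  have cx : (fun x : 'rV[R]_2 => (x, t)) @ phi z t --> (phi z t, t).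
    exact: (@cvg_pair _ _ _ (nbhs (phi z t)) (nbhs (phi z t)) (nbhs t) _ _ _
      id (fun=> t) cvg_id (cvg_cst t)).
  have Qx : \forall x \near phi z t, (spacetime phi @` W) (x, t) by exact: cx.
  apply: filterS Qx => x [[z' t'] Wz' [<- tt']] /=.
  rewrite tt' in Wz' *; have [_ It'] := WDI _ Wz'.
  by rewrite -uE // flow_velocity.
have curlE : curl (u^~ t) (phi z t) = pd 0 (fun x => velocity2 r theta f (x, t)) (phi z t)
    - pd 1 (fun x => velocity1 r theta f (x, t)) (phi z t).
  by rewrite /curl; congr (_ - _); apply: near_eq_derive; apply: filterS uV => x ->;
    rewrite ?vec2_1 ?vec2_0.
rewrite curlE -[in LHS]l2 -(@curl_velocity _ _ _ _ _ r_neq0 (phi z t, t)) //.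
congr (_ - _); rewrite /pd.
  by have [_ ->] := is_derive_slice_space (is_derive_velocity2
    r_smooth theta_smooth f_smooth r_neq0 (basis2 R 0, 0) dom).
by have [_ ->] := is_derive_slice_space (is_derive_velocity1
    r_smooth theta_smooth f_smooth r_neq0 (basis2 R 1, 0) dom).
Qed.

Lemma smooth_flow : smooth_on (D `*` I) (fun q => phi q.1 q.2).
Proof.
have oU : open (D `*` I) by exact: open_prod.
have tI (g : R -> R) : smooth_on I g -> smooth_on (D `*` I) (fun q => g q.2).
  by move=> sg; apply: smooth_time sg => // q [].
have sc : smooth_on (D `*` I) (fun q => cos (theta q.2)).
  by apply: smooth_cos_theta theta_smooth _ oU _ => q [].
have ss : smooth_on (D `*` I) (fun q => sin (theta q.2)).
  by apply: smooth_sin_theta theta_smooth _ oU _ => q [].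
have sx j : smooth_on (D `*` I) (fun q => q.1 0 j) by exact: smooth_coord.
have sf : smooth_on (D `*` I) (fun q => f (q.1 0 1)).
  by apply: smooth_comp f_smooth (sx 1) => // q [Dq _]; exact: f_def.
have sz := smooth_mul oU (tI _ (smooth_inv_r I_open r_smooth r_neq0)) (sx 1).
have ssh : smooth_on (D `*` I) (fun q => shear r a1 a2 f q.1 q.2).
  apply: smooth_mul (tI _ r_smooth) _ => //.
  apply: smooth_add (smooth_mul oU (tI _ a2_smooth) sf) => //.
  exact: smooth_add (sx 0) (smooth_mul oU (tI _ a1_smooth) (sx 1)).
rewrite (funext (fun q : spt => flowE r theta a1 a2 f q.1 q.2)).
apply: smooth_vec2 => //.
  apply: smooth_add (smooth_mul oU sc ssh) _ => //.
  by apply: smooth_opp => //; exact: smooth_mul.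
exact: smooth_add (smooth_mul oU ss ssh) (smooth_mul oU sc sz).
Qed.

(** Describing the image as a preimage under the explicit inverse makes its openness a matter of
    continuity, with no inverse function theorem. *)
Lemma image_flow (B : set R) (W : set spt) : W `<=` [set q | I q.2] ->
  (forall q, W q -> B (q.1 0 1)) ->
  spacetime phi @` W = domain r theta I B
    `&` (fun q => (label r theta a1 a2 f q, q.2)) @^-1` W.
Proof.
move=> WI WB; apply/seteqP; split=> [_ [[z t] Wzt <-]|[x t] [[It _] Wq]].
  have r0 := r_neq0 (WI _ Wzt); rewrite /spacetime /=; split; last first.
    by rewrite /= label_flow.
  by split; [exact: WI Wzt | rewrite /= label2_flow //; exact: WB Wzt].
exists (label r theta a1 a2 f (x, t), t) => //.
by rewrite /spacetime /= (@flow_label _ _ _ _ _ _ (x, t)) //; exact: r_neq0.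
Qed.

Lemma euler_flow (B : set R) (F : R -> R) : open B -> B `<=` E ->
  (forall x, B x -> is_derive x 1 F (f x)) ->
  euler_on (domain r theta I B) (fun x t => velocity r theta f (x, t))
    (fun x t => pressure r theta F (x, t)).
Proof.
move=> oB BE FB x t dom; have It : I t := dom.1.
have fB : smooth_on B f by exact: smooth_subset f_smooth.
have D1 v := is_derive_velocity1 r_smooth theta_smooth fB r_neq0 v dom.
have D2 v := is_derive_velocity2 r_smooth theta_smooth fB r_neq0 v dom.
have Dt := is_derive_slice_time (is_derive_vec2 (D1 (0, 1)) (D2 (0, 1))).
have Dx j := is_derive_slice_space
  (is_derive_vec2 (D1 (basis2 R j, 0)) (D2 (basis2 R j, 0))).
have Dp j := is_derive_pressure r_smooth theta_smooth r_neq0 FB (basis2 R j) dom.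
have timeE : derive1 (fun s => velocity r theta f (x, s)) t =
    vec2 (dvelocity1 r theta f (x, t) (0, 1)) (dvelocity2 r theta f (x, t) (0, 1)).
  by rewrite derive1E; exact: (@derive_val _ _ _ _ _ _ _ Dt).
have pdE j : pd j (fun y => velocity r theta f (y, t)) x =
    vec2 (dvelocity1 r theta f (x, t) (basis2 R j, 0))
         (dvelocity2 r theta f (x, t) (basis2 R j, 0)).
  exact: (@derive_val _ _ _ _ _ _ _ (Dx j)).
have gradE j : grad (fun y => pressure r theta F (y, t)) x 0 j =
    dpressure r theta f (x, t) (basis2 R j, 0).
  by rewrite mxE; exact: (@derive_val _ _ _ _ _ _ _ (Dp j)).
split.
  rewrite [derive1 _ _]timeE /convect sum_ord2 !pdE /velocity vec2_0 vec2_1.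
  have entry (u v w g : 'rV[R]_2) (a b : R) j :
    (u + (a *: v + b *: w) + g) 0 j = u 0 j + (a * v 0 j + b * w 0 j) + g 0 j.
    by rewrite !mxE.
  apply: vec2_inj; rewrite entry gradE ?vec2_0 ?vec2_1 [RHS]mxE.
    rewrite dvelocity1_linear.
    exact: (momentum1 theta f r_neq0 (q := (x, t)) It).
  rewrite dvelocity2_linear.
  exact: (momentum2 theta f r_neq0 (q := (x, t)) It).
rewrite /divergence sum_ord2.
have e1 : (fun y => velocity r theta f (y, t) 0 0) = (fun y => velocity1 r theta f (y, t)).
  by apply/funext => y; exact: vec2_0.
have e2 : (fun y => velocity r theta f (y, t) 0 1) = (fun y => velocity2 r theta f (y, t)).
  by apply/funext => y; exact: vec2_1.
rewrite e1 e2.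
rewrite [pd 0 _ _](@derive_val _ _ _ _ _ _ _ (is_derive_slice_space (D1 (basis2 R 0, 0)))).
rewrite [pd 1 _ _](@derive_val _ _ _ _ _ _ _ (is_derive_slice_space (D2 (basis2 R 1, 0)))).
exact: (divergence_free theta f r_neq0 (q := (x, t)) It).
Qed.

Lemma flow_euler_solution : gives_euler_solution D I phi.
Proof.
split; first exact: smooth_flow.
  by move=> z t Dz It; rewrite det_flow // oner_neq0.
move=> z t Dz It.
have [F [B [oB Bz BE FB]]] :=
  local_primitive E_open (smooth_continuous f_smooth) (f_def Dz).
have fB : smooth_on B f by exact: smooth_subset f_smooth.
have Fsm : smooth_on B F by exact: smooth_primitive FB fB.
(* Labels are restricted to those with z_2 in [B], where the primitive [F] is available. Since z_2
   is carried along by the flow, this holds for all times in [I] at once. *)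
pose D' := D `&` (fun y : 'rV[R]_2 => y 0 1) @^-1` B.
have oD' : open D'.
  by apply: open_setI_preimage => // y _; exact: coord_continuous.
pose W := D' `*` I.
have WI : W `<=` [set q | I q.2] by move=> q [].
have WB q : W q -> B (q.1 0 1) by move=> [[]].
have imE := image_flow WI WB.
have odom : open (domain r theta I B) by exact: open_domain.
have slab : smooth_on (domain r theta I B) (label r theta a1 a2 f).
  exact: smooth_label.
have oim : open (spacetime phi @` W).
  (* The time condition of [W] is already part of [domain], so only the condition on the label
     remains. *)
  rewrite imE (_ : _ `&` _ = domain r theta I B `&` label r theta a1 a2 f @^-1` D').
    exact: open_setI_preimage odom (smooth_continuous slab) oD'.
  by apply/seteqP; split=> q [dq] => [[Dq _]|Dq]; split=> //; split=> //; case: dq.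
exists W, (fun x s => velocity r theta f (x, s)), (fun x s => pressure r theta F (x, s)).
have pairE (T : Type) (g : spt -> T) : (fun q => g (q.1, q.2)) = g.
  by apply/funext => -[].
have subim : spacetime phi @` W `<=` domain r theta I B by rewrite imE => q [].
split.
- by [].
- split => //; first exact: open_prod.
  + by move=> q [[Dq _] Iq].
  (* Equal images share the time component, and at a common time [label] recovers z from the
     image. *)
  + move=> [z1 t1] [z2 t2]; rewrite !inE => -[_ /= I1] [_ /= I2] [e et].
    rewrite et in I1 e *.
    by rewrite -(@label_flow _ r theta a1 a2 f z1 t2) ?e ?label_flow //; exact: r_neq0.
  + by move=> z' t' [_ It']; exact: flow_velocity.
- rewrite (pairE _ (velocity r theta f)); apply: smooth_subset subim _.
  exact: smooth_velocity.
- rewrite (pairE _ (pressure r theta F)); apply: smooth_subset subim _.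
  exact: smooth_pressure.
- by move=> x s /subim; exact: euler_flow.
Qed.

End Main.

Theorem theorem3p1 (R : realType) (I : set R) (r theta a1 a2 : R -> R)
    (D : set 'rV[R]_2) (E : set R) (f : R -> R)
    (I_open : open I) (I_itv : is_interval I)
    (r_smooth : smooth_on I r) (theta_smooth : smooth_on I theta)
    (a1_smooth : smooth_on I a1) (a2_smooth : smooth_on I a2)
    (r_neq0 : forall t, I t -> r t != 0)
    (D_open : open D) (D_connected : connected D)
    (E_open : open E) (f_smooth : smooth_on E f)
    (f_def : forall z, D z -> E (z 0 1))
    (a1_eq : forall t, I t -> derive1 a1 t = 2 * derive1 theta t / r t ^+ 2)
    (a2_eq : forall t, I t -> derive1 a2 t = - (1 / r t ^+ 2)) :
  let phi := flow r theta a1 a2 f in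
  [/\ gives_euler_solution D I phi,
      forall z t, D z -> I t -> \det (dz phi z t) = 1 &
      is_vorticity D I phi (fun z _ => derive1 f (z 0 1))].
Proof.
move=> phi; split.
- exact: (flow_euler_solution I_open D_open E_open).
- by move=> z t Dz It; exact: (@det_flow R r theta a1 a2 f I D E).
- exact: (@vorticity_flow R r theta a1 a2 f I D E).
Qed.
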